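(* Let $q,r$ be positive integers, and let $\zeta(\alpha_1,\alpha_2,\ldots,\alpha_q+1)$ (with $\alpha_1,\dots,\alpha_q$ positive integers) be a multiple zeta value of depth $q$ and weight $\alpha_1+\cdots+\alpha_q+1=q+r$, with dual $\zeta(\beta_1,\beta_2,\ldots,\beta_r+1)$ of depth $r$. Put $\boldsymbol\alpha=(\alpha_1,\ldots,\alpha_q)$. Then for every nonnegative integer $m$ and every real $x$ with $x+1>0$, $$\sum_{1\le n_1<n_2<\cdots<n_r}B(n_r,1+x)\frac{P_m\left(H_{n_r}^{(1)}(x),\ldots,H_{n_r}^{(m)}(x)\right)}{n_1^{\beta_1}n_2^{\beta_2}\cdots n_r^{\beta_r}}=\sum_{|\boldsymbol d|=m}M_{q-1}(\boldsymbol\alpha,\boldsymbol d)\binom{\alpha_q+d_q}{d_q}\zeta(\alpha_1+d_1,\ldots,\alpha_{q-1}+d_{q-1},\alpha_q+d_q+1;x),$$ where the sum on the right is over all $q$-tuples $\boldsymbol d=(d_1,\ldots,d_q)$ of nonnegative integers with $|\boldsymbol d|=d_1+\cdots+d_q=m$.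
   Context: $B(\cdot,\cdot)$ is the Euler beta function; $H_n^{(s)}(x)=\sum_{j=1}^n(j+x)^{-s}$. The modified Bell polynomials are defined by $\exp\left(\sum_{k\ge1}\frac{x_k}{k}z^k\right)=\sum_{m\ge0}P_m(x_1,\ldots,x_m)z^m$. $$M_{q-1}(\boldsymbol\alpha,\boldsymbol d)=\prod_{j=1}^{q-1}\binom{\alpha_j+d_j-1}{d_j}$$ (equal to $1$ if $q=1$). For positive integers $\alpha_1,\dots,\alpha_q$ and $x>-1$, $$\zeta(\alpha_1,\ldots,\alpha_{q-1},\alpha_q+1;x)=\sum_{1\le n_1<\cdots<n_q}(n_1+x)^{-\alpha_1}\cdots(n_{q-1}+x)^{-\alpha_{q-1}}(n_q+x)^{-\alpha_q-1},$$ and the multiple zeta value $\zeta(\alpha_1,\ldots,\alpha_q+1)$ is the case $x=0$. Duality: let $\{1\}^a$ denote $a$ repetitions of $1$. Every index can be written uniquely as $(\alpha_1,\ldots,\alpha_q+1)=(\{1\}^{a_1},b_1+2,\{1\}^{a_2},b_2+2,\ldots,\{1\}^{a_\ell},b_\ell+2)$ with nonnegative integers $a_i,b_i$; its dual index is $(\beta_1,\ldots,\beta_r+1)=(\{1\}^{b_\ell},a_\ell+2,\{1\}^{b_{\ell-1}},a_{\ell-1}+2,\ldots,\{1\}^{b_1},a_1+2)$, and $\zeta(\beta_1,\ldots,\beta_r+1)$ is called the dual of $\zeta(\alpha_1,\ldots,\alpha_q+1)$. *)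

(* Defs.v *)
From mathcomp Require Import all_boot all_order all_algebra.
From mathcomp Require Import all_classical all_reals all_analysis.

Set Implicit Arguments.
Unset Strict Implicit.
Unset Printing Implicit Defensive.

Import Order.TTheory GRing.Theory Num.Theory.
Import numFieldNormedType.Exports.

Local Open Scope classical_set_scope.
Local Open Scope ring_scope.

(* B(a, b); the integral converges for a, b > 0. The library's [beta_fun] only
   covers natural parameters. *)
Definition euler_beta (R : realType) (a b : R) : R :=
  \int[@lebesgue_measure R]_(t in `]0, 1[) (t `^ (a - 1) * (1 - t) `^ (b - 1)).

(* H_n^{(s)}(x) *)
Definition harmonic_sum (R : realType) (s n : nat) (x : R) : R :=
  \sum_(1 <= j < n.+1) (j%:R + x) ^- s.

(* exp(sum_(k >= 1) x_k / k z^k) as a formal series in z, with the inner series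
   cut at degree N and the exponential series cut at order N. Since the inner
   series has no constant term, the cuts do not alter the coefficients of
   degree at most N; this is [bell_polyE] below. *)
Definition bell_exp (R : fieldType) (N : nat) (x : nat -> R) : {poly R} :=
  \sum_(j < N.+1)
    (j`!%:R)^-1 *: (\sum_(1 <= k < N.+1) (x k / k%:R) *: 'X^k) ^+ j.

(* The modified Bell polynomial P_m(x_1, ..., x_m). *)
Definition bell_poly (R : fieldType) (m : nat) (x : nat -> R) : R :=
  (bell_exp m x)`_m.

Lemma bell_polyE (R : fieldType) (N m : nat) (x : nat -> R) :
  (m <= N)%N -> (bell_exp N x)`_m = bell_poly m x.
Proof.
move=> mN; rewrite /bell_poly /bell_exp.
set p := fun M => \sum_(1 <= k < M.+1) (x k / k%:R) *: 'X^k : {poly R}.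
have pX M : exists g, p M = 'X * g.
  exists (\sum_(1 <= k < M.+1) (x k / k%:R) *: 'X^(k.-1)).
  rewrite /p mulr_sumr; apply: eq_big_nat => -[//|k] _ /=.
  by rewrite -scalerAr -exprS.
have [h ph] : exists h, p N = p m + 'X^(m.+1) * h.
  exists (\sum_(m.+1 <= k < N.+1) (x k / k%:R) *: 'X^(k - m.+1)).
  rewrite /p (@big_cat_nat _ _ _ m.+1) //=; congr (_ + _).
  rewrite mulr_sumr; apply: eq_big_nat => k /andP[mk _].
  by rewrite -scalerAr -exprD subnKC.
have pj j : exists c, p N ^+ j = p m ^+ j + 'X^(m.+1) * c.
  elim: j => [|j [c IHj]]; first by exists 0; rewrite !expr0 mulr0 addr0.
  exists (p m * c + h * (p m ^+ j + 'X^(m.+1) * c)).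
  rewrite !(exprS _ j) IHj {1}ph; set a := p m; set b := a ^+ j.
  by rewrite mulrDl [a * _]mulrDr -addrA [a * (_ * c)]mulrCA -mulrA -mulrDr.
rewrite !coef_sum.
rewrite (big_ord_widen N.+1 (fun j => ((j`!%:R)^-1 *: p m ^+ j)`_m)) //.
rewrite [RHS]big_mkcond /=.
apply: eq_bigr => -[j jN] _ /=; rewrite -/(p N) !coefZ.
case: ltnP => [_|mj].
  by have [c ->] := pj j; rewrite coefD coefXnM ltnSn addr0.
by have [g ->] := pX N; rewrite exprMn coefXnM mj mulr0.
Qed.

(* The tuples 1 <= n_1 < ... < n_q. *)
Definition increasing (q : nat) : set (seq nat) :=
  [set n | size n = q /\ path ltn 0%N n].

(* zeta(s_1, ..., s_q; x), for the full list of exponents s. For x > -1 all the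
   terms are positive, as [esum] requires; the value is +oo on divergence. *)
Definition mzeta (R : realType) (s : seq nat) (x : R) : \bar R :=
  \esum_(n in increasing (size s))
    (\prod_(i < size s) ((nth 0%N n i)%:R + x) ^- nth 0%N s i)%:E.

(* ({1}^{a_1}, b_1 + 2, ..., {1}^{a_l}, b_l + 2) for
   ab = [:: (a_1, b_1); ...; (a_l, b_l)]. *)
Definition index_of_blocks (ab : seq (nat * nat)) : seq nat :=
  flatten [seq rcons (nseq c.1 1%N) (c.2 + 2)%N | c <- ab].

Definition dual_index (s t : seq nat) : Prop :=
  exists ab : seq (nat * nat),
    s = index_of_blocks ab /\
    t = index_of_blocks (rev [seq (c.2, c.1) | c <- ab]).

(* (a_1, ..., a_{q-1}, a_q + 1), for nonempty a. *)
Definition incr_last (a : seq nat) : seq nat := incr_nth a (size a).-1.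

(* M_{q-1}(a, d) with q = size a. *)
Definition Mcoef (a d : seq nat) : nat :=
  \prod_(j < (size a).-1)
    'C(nth 0%N a j + nth 0%N d j - 1, nth 0%N d j).

(* Main.v *)
Require Import Defs.
From mathcomp Require Import all_boot all_order all_algebra.
From mathcomp Require Import all_classical all_reals all_analysis.
From mathcomp Require Import measurable_realfun ring lra zify.

Set Implicit Arguments.
Unset Strict Implicit.
Unset Printing Implicit Defensive.

Import Order.TTheory GRing.Theory Num.Theory.
Import numFieldNormedType.Exports.

Local Open Scope classical_set_scope.
Local Open Scope ring_scope.

(** The identity holds because both sides are the coefficient of [z ^ m] in one
    identity between functions of [x - z], its case [m = 0].

    On the left, [B(n, 1 + x) = (n-1)! / \prod_(1 <= j <= n) (j + x)], and the
    formal identity [exp (\sum_k p_k z^k / k) = \prod_j (1 - t_j z)^-1] for the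
    power sums [p_k] of the [t_j = 1/(j + x)] says that [P_m(H_n^(1)(x), ...)] is
    the complete homogeneous symmetric function [h_m(t_1, ..., t_n)]
    ([bell_poly_complete_sym]). Hence
    [\sum_m B(n, 1 + x) P_m z^m = B(n, 1 + x - z)] ([pser_connector]). On the
    right, the binomial series of [(n + x - z)^-s] produces the binomial
    coefficients and the raised exponents ([pser_zeta_term]). All coefficients
    are nonnegative, so sums may be exchanged freely, and two power series with
    nonnegative coefficients that agree and are finite near 0 have the same
    coefficients ([pser_inj]).

    The case [m = 0] is [mzeta_dual]. It is proved with the connected sums of
    Seki and Yamamoto: a sum over two increasing tuples [M] and [N], coupled only
    through their last entries by the factor
    [c(n, m) = \prod_(1 <= j <= n) j / (j + m + x)]. Two telescoping sums
    ([esum_connectorr], [esum_connectorl]) move exponents one unit at a time from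
    the index of [M] to the index of [N] without changing the connected sum. The
    multiple zeta value is the connected sum with [N] empty; moving everything
    across turns its index into the dual one and leaves the factor
    [c(n_r, 0) = n_r B(n_r, 1 + x)], whose [n_r] lowers the last exponent
    [beta_r + 1] to [beta_r].

    Finiteness also comes from this duality: up to a constant, every convergent
    [mzeta] is at most the one of index [(1, ..., 1, 2)] at [x = 0], whose dual
    is a single series [\sum_n n^-(p+2)]. *)

(** * The beta function at a positive integer *)

Section EulerBeta.
Variable R : realType.
Notation mu := (@lebesgue_measure R).

Lemma is_derive_onem_powR (p t : R) : t < 1 ->
  is_derive t 1 (fun u => (1 - u) `^ p) (- (p * (1 - t) `^ (p - 1))).
Proof.
move=> t1; have t1' : 0 < 1 - t by rewrite subr_gt0.
have dB : is_derive t 1 (fun u : R => 1 - u) (- 1).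
  by rewrite -[- 1]sub0r; apply: is_deriveB.
have dP := @is_derive1_powR R p (1 - t) t1'.
have := @is_derive1_comp R (fun u => u `^ p) (fun u => 1 - u) t _ _ dP dB.
by rewrite mulrN1.
Qed.

Lemma integral_onem_powR_trunc (y c : R) : 0 < y -> 0 < c -> c < 1 ->
  (\int[mu]_(t in `[0%R, c]) ((1 - t) `^ (y - 1))%:E
   = ((1 - (1 - c) `^ y) / y)%:E)%E.
Proof.
move=> y0 c0 c1; have yN0 : y != 0 by rewrite gt_eqF.
pose F := fun t : R => - y^-1 * (1 - t) `^ y.
have dF (t : R) : t < 1 -> is_derive t 1 F ((1 - t) `^ (y - 1)).
  move=> t1; have d1 := is_derive_onem_powR y t1.
  have := @is_deriveZ _ _ _ (fun u : R => (1 - u) `^ y) (- y^-1) t 1 _ d1.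
  by rewrite /GRing.scale/= mulrNN mulrA mulVf // mul1r.
have cF : {within `[0, c], continuous F}.
  apply: derivable_within_continuous => t; rewrite in_itv/= => /andP[_ tc].
  by have [] := dF t (le_lt_trans tc c1).
rewrite (@continuous_FTC2 _ _ F) //; last 1 first.
- move=> t; rewrite in_itv/= => /andP[_ tc].
  by rewrite derive1E; have [_ ->] := dF t (lt_trans tc c1).
- rewrite -EFinB; congr (_%:E); rewrite /F subr0 powR1.
  by field.
- apply: derivable_within_continuous => t; rewrite in_itv/= => /andP[_ tc].
  by have [] := is_derive_onem_powR (y - 1) (le_lt_trans tc c1).
- move/continuous_within_itvP : cF => /(_ c0)[_ cl cr]; split => //.
  move=> t; rewrite in_itv/= => /andP[_ tc].
  by have [] := dF t (lt_trans tc c1).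
Qed.

Lemma measurable_onem_powR (p : R) (D : set R) : measurable D ->
  measurable_fun D (fun t : R => (1 - t) `^ p).
Proof.
move=> mD; apply: (measurable_funS measurableT) => //.
apply: (measurableT_comp (measurable_powR p)) => //.
by apply: measurable_funB.
Qed.

(** The integrand is unbounded near 1 when [y < 1], so the integral is the
    limit of those over [0, 1 - 1/(n+2)]. *)
Lemma integral_onem_powR (y : R) : 0 < y ->
  (\int[mu]_(t in `]0%R, 1%R[) ((1 - t) `^ (y - 1))%:E = (y^-1)%:E)%E.
Proof.
move=> y0; pose c n : R := 1 - n.+2%:R^-1.
have c0 n : 0 < c n by rewrite subr_gt0 invf_lt1 ?ltr0n // ltr1n.
have c1 n : c n < 1 by rewrite ltrBlDr ltrDl invr_gt0 ltr0n.
have mf D : measurable D ->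
    measurable_fun D (fun t : R => ((1 - t) `^ (y - 1))%:E).
  by move=> mD; apply/measurable_EFinP; exact: measurable_onem_powR.
rewrite integral_itv_obnd_cbnd; last by apply: mf.
have -> : `[(0 : R), 1[%classic = \bigcup_n `[0, c n]%classic.
  apply/seteqP; split => [t|t [n _]] /=; rewrite !in_itv/= => /andP[t0 t1].
    have [n nt] : exists n, (1 - t)^-1 < n%:R.
      by exists (Num.truncn (1 - t)^-1).+1; exact: truncnS_gt.
    exists n => //=; rewrite in_itv/= t0 /c lerBrDr -lerBrDl.
    rewrite invf_ple ?posrE ?ltr0n ?subr_gt0 //.
    by rewrite (le_trans (ltW nt)) // ler_nat; lia.
  by rewrite t0 (le_lt_trans t1).
have nd : nondecreasing_seq (fun n => `[0, c n]%classic : set R).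
  move=> m n mn; rewrite subsetEset; apply: subset_itvl.
  by rewrite bnd_simp lerD2l lerN2 lef_pV2 ?posrE ?ltr0n // ler_nat; lia.
have /cvg_lim <- // : (\int[mu]_(t in `[0%R, c n]) ((1 - t) `^ (y - 1))%:E)%E
    @[n --> \oo] --> (\int[mu]_(t in \bigcup_n `[0%R, c n]%classic)
      ((1 - t) `^ (y - 1))%:E)%E.
  apply: ge0_nondecreasing_set_cvg_integral => // [n|n t _].
    exact: mf.
  by rewrite lee_fin powR_ge0.
apply/cvg_lim => //.
under eq_fun do rewrite integral_onem_powR_trunc//.
apply: cvg_EFin; first exact: nearW.
rewrite [X in _ --> X](_ : _ = (1 - 0) / y); last by rewrite subr0 mul1r.
apply: cvgM; last exact: cvg_cst.
apply: cvgB; first exact: cvg_cst.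
have /cvg_at_rightP := powR_cvg0 y0; apply; split.
  by move=> n; rewrite opprB addrC subrK invr_gt0 ltr0n.
rewrite /c; under eq_fun do rewrite opprB addrC subrK.
by have := @cvg_harmonic R; rewrite -cvg_shiftS.
Qed.

(** Since [t = 1 - (1 - t)], linearity gives [B(n+1, y) = B(n, y) - B(n, y+1)],
    so only the integral with [n = 0] has to be computed; the same equation
    propagates integrability, which linearity needs. *)
Lemma beta_integral_nat (n : nat) (y : R) : 0 < y ->
  let f (t : R) := t ^+ n * (1 - t) `^ (y - 1) in
  mu.-integrable `]0, 1[ (EFin \o f) /\
  \int[mu]_(t in `]0, 1[) f t = n`!%:R / \prod_(j < n.+1) (y + j%:R).
Proof.
elim: n y => [|n IHn] y y0 /=.
  have Ey := integral_onem_powR y0.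
  rewrite (_ : (fun t : R => _) = fun t => (1 - t) `^ (y - 1)); last first.
    by apply/funext => t; rewrite expr0 mul1r.
  split; last first.
    by rewrite /Rintegral Ey /= big_ord1 fact0 addr0 div1r.
  apply/integrableP; split.
    by apply/measurable_EFinP; exact: measurable_onem_powR.
  under eq_integral do rewrite gee0_abs ?lee_fin ?powR_ge0//=.
  by rewrite Ey ltry.
have [i1 e1] := IHn y y0.
have [i2 e2] := IHn (y + 1) (addr_gt0 y0 ltr01).
have fE (t : R) : t \in `]0, 1[%classic ->
    t ^+ n.+1 * (1 - t) `^ (y - 1) =
    t ^+ n * (1 - t) `^ (y - 1) - t ^+ n * (1 - t) `^ (y + 1 - 1).
  rewrite inE /= in_itv/= => /andP[t0 t1].
  have -> : (1 - t) `^ (y + 1 - 1) = (1 - t) `^ (y - 1) * (1 - t).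
    have t1' : 0 < 1 - t by rewrite subr_gt0.
    have powS : (y - 1 + 1 == 0) ==> (1 - t != 0) by rewrite (gt_eqF t1') implybT.
    by rewrite addrAC (powRD powS) powRr1 // ltW.
  by rewrite exprS; ring.
split.
  have mI : measurable (`]0, 1[%classic : set (measurableTypeR R)) by [].
  have i12 := integrableB mI i1 i2.
  by apply: (eq_integrable mI _ _ _ i12) => t tI /=; rewrite fE // EFinB.
transitivity (\int[mu]_(t in `]0, 1[)
    (t ^+ n * (1 - t) `^ (y - 1) - t ^+ n * (1 - t) `^ (y + 1 - 1))).
  by apply: eq_Rintegral => t tI; exact: fE.
rewrite RintegralB // e1 e2.
have yj j : y + j%:R != 0 by rewrite gt_eqF // ltr_wpDr.
rewrite [in LHS]big_ord_recl [X in _ / (_ * X) - _](eq_bigr (fun j : 'I_n => y + 1 + j%:R)); last first.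
  by move=> j _; rewrite /= /bump /= natrD addrA.
rewrite [X in _ - _ / X]big_ord_recr /= [in RHS]big_ord_recl [in RHS]big_ord_recr /=.
rewrite [in RHS](eq_bigr (fun j : 'I_n => y + 1 + j%:R)); last first.
  by move=> j _; rewrite /= /bump /= natrD addrA.
have pN0 : \prod_(j < n) (y + 1 + j%:R) != 0.
  by apply/prodf_neq0 => j _; rewrite -addrA nat1r.
have yn := yj n.+1.
rewrite factS natrM /bump /= add1n -nat1r addrA in yn *.
rewrite addr0; have y00 := lt0r_neq0 y0.
by field; rewrite yn pN0 y00.
Qed.

Lemma euler_beta_nat (n : nat) (y : R) : (0 < n)%N -> 0 < y ->
  euler_beta n%:R y = n.-1`!%:R / \prod_(j < n) (y + j%:R).
Proof.
case: n => // n _ y0; have [_ <-] := beta_integral_nat n y0.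
apply: eq_Rintegral => t; rewrite inE /= in_itv/= => /andP[t0 _].
by rewrite -natr1 addrK powR_mulrn // ltW.
Qed.

End EulerBeta.

(** * Modified Bell polynomials of harmonic sums *)

Section Convolution.
Variable R : comNzRingType.
Implicit Type a : nat -> nat -> R.

(** The coefficient of [z ^ m] in [\prod_(i < q) \sum_k a i k z ^ k]. *)
Fixpoint convolution a (q m : nat) : R :=
  match q with
  | 0 => (m == 0%N)%:R
  | q'.+1 => \sum_(i < m.+1) a q' i * convolution a q' (m - i)
  end.
Arguments convolution : simpl never.

Lemma convolutionS a q m :
  convolution a q.+1 m = \sum_(i < m.+1) a q i * convolution a q (m - i).
Proof. by []. Qed.

Let convolution_poly a q N m : (m <= N)%N ->
  (\prod_(i < q) \poly_(k < N.+1) a i k)`_m = convolution a q m.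
Proof.
elim: q m => [|q IHq] m mN; first by rewrite big_ord0 coef1.
rewrite big_ord_recr /= mulrC coefM convolutionS; apply: eq_bigr => i _.
rewrite coef_poly ltnS (leq_trans (leq_ord i)) // IHq //.
by rewrite (leq_trans (leq_subr _ _)).
Qed.

(** The nested sums are the coefficient of a product of truncated series, which
    distributivity expands over all choices of one exponent per factor. *)
Lemma convolution_tuple a q m : convolution a q m =
  \sum_(d : q.-tuple 'I_m.+1 | (\sum_(i < q) tnth d i)%N == m)
    \prod_(i < q) a i (tnth d i).
Proof.
rewrite -(@convolution_poly a q m) //.
under eq_bigr do rewrite poly_def.
rewrite bigA_distr_bigA coef_sum [RHS]big_mkcond /=.
rewrite (reindex (fun d : q.-tuple 'I_m.+1 => [ffun i => tnth d i])) /=; last first.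
  exists (fun f : {ffun 'I_q -> 'I_m.+1} => [tuple f i | i < q]) => [d _|f _].
    by apply: eq_from_tnth => i; rewrite tnth_mktuple ffunE.
  by apply/ffunP => i; rewrite ffunE tnth_mktuple.
apply: eq_bigr => d _; under eq_bigr do rewrite ffunE -mul_polyC.
rewrite big_split /= -rmorph_prod /= -expr_sum coefCM coefXn eq_sym.
by case: eqP; rewrite ?mulr1 ?mulr0.
Qed.

End Convolution.

Section BellComplete.
Variable R : numFieldType.

Lemma bell_poly0 (x : nat -> R) : bell_poly 0 x = 1.
Proof.
by rewrite /bell_poly /bell_exp big_ord1 expr0 fact0 invr1 scale1r coef1.
Qed.

(** The coefficientwise form of [E' = p' * E] for [E = exp p]. The truncated
    exponential satisfies it up to the term [p' * p ^ N / N!], which has no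
    coefficient of degree less than [N]. *)
Lemma bell_poly_rec (m : nat) (x : nat -> R) :
  m.+1%:R * bell_poly m.+1 x = \sum_(i < m.+1) x i.+1 * bell_poly (m - i) x.
Proof.
pose p : {poly R} := \sum_(1 <= k < m.+2) (x k / k%:R) *: 'X^k.
have coefp k : p`_k.+1 = if (k < m.+1)%N then x k.+1 / k.+1%:R else 0.
  rewrite /p coef_sum; case: ltnP => km.
    rewrite (bigD1_seq k.+1) ?mem_index_iota ?iota_uniq //= coefZ coefXn eqxx.
    rewrite mulr1 big1 ?addr0 // => j jk.
    by rewrite coefZ coefXn eq_sym (negPf jk) mulr0.
  rewrite big1_seq // => j; rewrite mem_index_iota => /andP[_ jm].
  by rewrite coefZ coefXn gtn_eqF ?mulr0 //; lia.
have [g pX] : exists g, p = 'X * g.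
  exists (\sum_(1 <= k < m.+2) (x k / k%:R) *: 'X^(k.-1)).
  rewrite /p mulr_sumr; apply: eq_big_nat => -[//|k] _ /=.
  by rewrite -scalerAr -exprS.
pose E := bell_exp m.+1 x.
have dE : E^`() = p^`() * (E - (m.+1)`!%:R^-1 *: p ^+ m.+1).
  rewrite /E /bell_exp -/p [in RHS]big_ord_recr /= addrK.
  rewrite raddf_sum /= mulr_sumr big_ord_recl expr0 alg_polyC derivC add0r.
  apply: eq_bigr => j _; rewrite derivZ deriv_exp /= add0n /bump add1n.
  rewrite -[X in _ *: X = _]scaler_nat -scalerAr scalerA factS natrM invfM mulrAC.
  by rewrite mulVf ?pnatr_eq0 // mul1r.
have := congr1 (fun q : {poly R} => q`_m) dE.
rewrite coef_deriv mulrBr coefB [X in _ - X](_ : _ = 0); last first.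
  by rewrite -scalerAr coefZ pX exprMn mulrCA coefXnM ltnSn mulr0.
rewrite subr0 coefM /E bell_polyE // mulr_natl => ->; rewrite -/E.
apply: eq_bigr => i _; rewrite coef_deriv coefp ltn_ord.
rewrite /E bell_polyE; last by lia.
by rewrite -[_ *+ _]mulr_natr divfK // pnatr_eq0.
Qed.

(** [h_m(t_1, ..., t_n)], the coefficient of [z ^ m] in
    [\prod_(1 <= j <= n) (1 - t_j z)^-1]. *)
Definition complete_sym (t : nat -> R) (n m : nat) : R :=
  convolution (fun j i => t j.+1 ^+ i) n m.

Lemma complete_symS t n m : complete_sym t n.+1 m =
  \sum_(i < m.+1) t n.+1 ^+ i * complete_sym t n (m - i).
Proof. by []. Qed.

Lemma complete_sym0 t n : complete_sym t n 0 = 1.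
Proof. by elim: n => [|n IHn] //; rewrite complete_symS big_ord1 expr0 mul1r. Qed.

Lemma complete_symSS t n m : complete_sym t n.+1 m.+1 =
  complete_sym t n m.+1 + t n.+1 * complete_sym t n.+1 m.
Proof.
rewrite 2!complete_symS big_ord_recl expr0 mul1r subn0; congr (_ + _).
rewrite mulr_sumr; apply: eq_bigr => i _.
by rewrite /bump /= exprS mulrA subSS.
Qed.

(** Newton's identity [m h_m = \sum_k p_k h_(m-k)]: the complete symmetric
    functions obey the recursion of [bell_poly_rec]. Passing from [n] to [n + 1]
    variables, [complete_symSS] expresses the new [h] in terms of the old one. *)
Lemma complete_sym_newton (t : nat -> R) n m :
  m.+1%:R * complete_sym t n m.+1 =
  \sum_(i < m.+1) (\sum_(1 <= j < n.+1) t j ^+ i.+1) * complete_sym t n (m - i).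
Proof.
elim: n m => [|n IHn] m.
  by rewrite mulr0 big1 // => i _; rewrite big_geq // mul0r.
elim: m => [|m IHm].
  have := IHn 0%N; rewrite !big_ord1 !subnn complete_symSS !complete_sym0.
  by rewrite !mul1r !mulr1 => ->; rewrite [in RHS]big_nat_recr.
pose p i := \sum_(1 <= j < n.+1) t j ^+ i.+1.
have pS i : \sum_(1 <= j < n.+2) t j ^+ i.+1 = p i + t n.+1 ^+ i.+1.
  by rewrite big_nat_recr.
under [in RHS]eq_bigr do rewrite pS mulrDl.
rewrite [in RHS]big_split /= [X in _ = _ + X]big_ord_recl subn0 expr1.
rewrite [X in _ = X + _]big_ord_recr /= subnn.
rewrite complete_sym0 mulr1.
rewrite complete_symSS mulrDr IHn -natr1 mulrDl mul1r mulrCA IHm.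
under [X in _ + (t n.+1 * X + _) = _]eq_bigr do rewrite pS mulrDl.
rewrite [X in _ + (t n.+1 * X + _)]big_split /=.
rewrite big_ord_recr /= subnn complete_sym0 mulr1 -/(p _).
under [X in _ = X + _ + _]eq_bigr => i _.
  rewrite (subSn (leq_ord i)) complete_symSS mulrDr mulrCA; over.
rewrite [in RHS]big_split /= -mulr_sumr.
under [X in _ = _ + (_ + X)]eq_bigr => i _.
  rewrite /bump add1n subSS exprS -mulrA; over.
under [X in X + _ + _ = _]eq_bigr => i _ do rewrite (subSn (leq_ord i)) -/(p i).
by rewrite -mulr_sumr; ring.
Qed.

Lemma bell_poly_complete_sym (x : R) n m :
  bell_poly m (fun k => \sum_(1 <= j < n.+1) (j%:R + x) ^- k) =
  complete_sym (fun j => (j%:R + x)^-1) n m.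
Proof.
have [k] := ubnP m; elim: k m => // k IHk [_|m mk].
  by rewrite bell_poly0 complete_sym0.
apply: (@mulfI _ m.+1%:R); first by rewrite pnatr_eq0.
rewrite bell_poly_rec complete_sym_newton; apply: eq_bigr => i _.
rewrite IHk; last by lia.
by congr (_ * _); apply: eq_bigr => j _; rewrite exprVn.
Qed.

End BellComplete.

(** * Unconditional sums over increasing tuples *)

Section EsumExtra.
Variable R : realType.

Lemma esumZl (T : choiceType) (I : set T) (c : R) (a : T -> \bar R) :
  0 <= c -> (forall i, I i -> (0 <= a i)%E) ->
  \esum_(i in I) (c%:E * a i)%E = (c%:E * \esum_(i in I) a i)%E.
Proof.
have le_esumZl (d : R) (b : T -> \bar R) : 0 <= d ->
    (forall i, I i -> (0 <= b i)%E) ->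
    (\esum_(i in I) (d%:E * b i) <= d%:E * \esum_(i in I) b i)%E.
  move=> d0 b0; apply: ge_ereal_sup => _ [X [finX XI]] <-.
  have -> : (\sum_(i \in X) d%:E * b i = d%:E * \sum_(i \in X) b i)%E.
    rewrite !fsbig_finite // big_seq [in RHS]big_seq ge0_sume_distrr // => i.
    by rewrite in_fset_set // inE => /XI/b0.
  by apply: lee_wpmul2l; rewrite ?lee_fin //; apply: esum_ge; exists X.
rewrite le_eqVlt => /predU1P[<- _|c0 a0].
  by rewrite mul0e esum1 // => i _; rewrite mul0e.
apply/eqP; rewrite eq_le le_esumZl ?(ltW c0) //=.
rewrite -[X in (X <= _)%E]mul1e.
have := @le_esumZl c^-1 (fun i => c%:E * a i)%E.
rewrite invr_ge0 (ltW c0) => /(_ isT).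
have -> : \esum_(i in I) (c^-1%:E * (c%:E * a i))%E = \esum_(i in I) a i.
  by apply: eq_esum => i _; rewrite muleA -EFinM mulVf ?gt_eqF // mul1e.
move=> h; rewrite mul1e -lee_pdivlMl //; apply: h => i Ii.
by rewrite mule_ge0 ?lee_fin ?(ltW c0) ?a0.
Qed.

Lemma esum_exchange (T1 T2 : choiceType) (I : set T1) (J : set T2)
    (a : T1 -> T2 -> \bar R) :
  (forall i j, I i -> J j -> (0 <= a i j)%E) ->
  \esum_(i in I) \esum_(j in J) a i j = \esum_(j in J) \esum_(i in I) a i j.
Proof.
move=> a0; rewrite !esum_esum; [|by move=> *; apply: a0..].
apply: (reindex_esum (J `*`` fun=> I) _ (fun k => (k.2, k.1))); split => /=.
- by move=> [j i] [].
- by move=> [j1 i1] [j2 i2] _ _ [-> ->].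
- by move=> [i j] [Ii Jj]; exists (j, i).
Qed.

Lemma esum_telescope (f u : nat -> R) (n : nat) :
  (forall k, (n <= k)%N -> f k.+1 = u k - u k.+1) ->
  (forall k, (n < k)%N -> 0 <= f k) -> u @ \oo --> 0 ->
  \esum_(k in [set k | (n < k)%N]) (f k)%:E = (u n)%:E.
Proof.
move=> fu f0 u0.
rewrite (reindex_esum setT _ (fun i => n.+1 + i)%N); last first.
  split=> [i _ /=|i j _ _ /addnI //|k /= nk]; first by rewrite addSn ltnS leq_addr.
  by exists (k - n.+1)%N => //; rewrite subnKC.
rewrite -nneseries_esumT; last first.
  by move=> i; rewrite lee_fin f0 // addSn ltnS leq_addr.
apply/cvg_lim => //.
have -> : (fun N => \sum_(0 <= i < N) (f (n.+1 + i)%N)%:E)%E =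
    (fun N => (u n - u (N + n)%N)%:E).
  apply/funext => N; rewrite sumEFin; congr (_%:E).
  rewrite (telescope_sumr_eq (fun i => - u (n + i)%N)) // => [|i _].
    by rewrite addn0 opprK addrC addnC.
  by rewrite addSn fu ?leq_addr // opprK addrC addnS.
apply: cvg_EFin; first exact: nearW.
rewrite -[X in _ --> X]subr0; apply: cvgB; first exact: cvg_cst.
by rewrite cvg_shiftn.
Qed.

Lemma increasing0 : increasing 0 = [set [::]].
Proof. by apply/seteqP; split => [n [/size0nil]|_ ->]. Qed.

Lemma increasing_rcons q n k :
  increasing q.+1 (rcons n k) <-> increasing q n /\ (last 0 n < k)%N.
Proof.
rewrite /increasing /= size_rcons rcons_path; split.
  by move=> [[sn] /andP[pn nk]].
by move=> [[-> pn] nk]; rewrite pn.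
Qed.

Lemma increasing_last_gt0 q n : increasing q.+1 n -> (0 < last 0 n)%N.
Proof.
case/lastP: n => [[]//|n k] /increasing_rcons[_]; rewrite last_rcons.
exact: leq_ltn_trans.
Qed.

(** The last entry of an increasing tuple is summed first, which is how the
    connected sums below are manipulated. *)
Lemma esum_increasing_rcons q (F : seq nat -> \bar R) :
  (forall n, increasing q.+1 n -> (0 <= F n)%E) ->
  \esum_(n in increasing q.+1) F n =
  \esum_(n in increasing q) \esum_(k in [set k | (last 0 n < k)%N]) F (rcons n k).
Proof.
move=> F0; rewrite esum_esum; last first.
  by move=> n k qn nk; apply/F0/increasing_rcons.
apply: (reindex_esum _ _ (fun p => rcons p.1 p.2)); split => /=.
- by move=> [n k] /= [qn nk]; apply/increasing_rcons.
- by move=> [n k] [n' k'] _ _ /= /rcons_inj.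
- case/lastP => [[]//|n k] /increasing_rcons[qn nk].
  by exists (n, k).
Qed.

End EsumExtra.

(** * The connector *)

Section ZetaTerm.
Variable R : realType.

Definition zeta_term (z : R) (s n : seq nat) : R :=
  \prod_(i < size s) ((nth 0%N n i)%:R + z) ^- nth 0%N s i.

Lemma zeta_term_rcons z s a n k : size n = size s ->
  zeta_term z (rcons s a) (rcons n k) = zeta_term z s n * (k%:R + z) ^- a.
Proof.
move=> sn; rewrite /zeta_term size_rcons big_ord_recr /=.
rewrite !nth_rcons sn ltnn eqxx; congr (_ * _); apply: eq_bigr => i _.
by rewrite !nth_rcons sn ltn_ord.
Qed.

Lemma zeta_term_ge0 z s n : 0 < z + 1 -> increasing (size s) n ->
  0 <= zeta_term z s n.
Proof.
move=> z1; elim/last_ind: s n => [n _|s a IHs n].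
  by rewrite /zeta_term big_ord0.
rewrite size_rcons; case/lastP: n => [[]//|n k] /increasing_rcons[sn nk].
rewrite zeta_term_rcons; last by case: sn.
rewrite mulr_ge0 ?IHs // invr_ge0 exprn_ge0 //.
by case: k nk => // k _; rewrite -natr1 -addrA addr_ge0 ?ler0n // addrC ltW.
Qed.

End ZetaTerm.

Section Connector.
Variables (R : realType) (y : R).
Hypothesis y_gtN1 : 0 < y + 1.

Let natDy_gt0 (m : nat) : (0 < m)%N -> 0 < m%:R + y.
Proof. by case: m => // m _; rewrite -natr1 -addrA [1 + y]addrC ltr_wpDl. Qed.

(** [n! / \prod_(1 <= j <= n) (j + m + y)], that is
    [n! Gamma(m + y + 1) / Gamma(n + m + y + 1)]. *)
Definition connector (n m : nat) : R :=
  \prod_(1 <= j < n.+1) (j%:R / (j%:R + (m%:R + y))).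

Let den_gt0 (j m : nat) : (0 < j)%N -> 0 < j%:R + (m%:R + y).
Proof.
by move=> j0; rewrite addrA -natrD natDy_gt0 // addn_gt0 j0.
Qed.

Lemma connector0 m : connector 0 m = 1.
Proof. by rewrite /connector big_geq. Qed.

Lemma connectorSl n m :
  connector n.+1 m = connector n m * (n.+1%:R / (n.+1%:R + (m%:R + y))).
Proof. by rewrite /connector big_nat_recr. Qed.

Lemma connectorSr n m :
  connector n m.+1 * (n%:R + (m.+1%:R + y)) = connector n m * (m.+1%:R + y).
Proof.
elim: n => [|n IHn]; first by rewrite !connector0 add0r.
have d1 := lt0r_neq0 (den_gt0 m.+1 (ltn0Sn n)).
have d2 := lt0r_neq0 (den_gt0 m (ltn0Sn n)).
rewrite !connectorSl mulrAC [in RHS]mulrAC -IHn.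
have e : n.+1%:R + (m%:R + y) = n%:R + (m.+1%:R + y) by rewrite -!natr1; ring.
rewrite e; rewrite e in d2.
by rewrite -!mulrA !(mulrCA (_ + _) n.+1%:R) !divff.
Qed.

Lemma connector_gt0 n m : 0 < connector n m.
Proof.
rewrite /connector big_nat; apply: prodr_gt0 => j /andP[j0 _].
by rewrite divr_gt0 ?den_gt0 ?ltr0n.
Qed.

Lemma connector_ge0 n m : 0 <= connector n m.
Proof. exact/ltW/connector_gt0. Qed.

Lemma connector_diffr n m : (0 < n)%N ->
  (m.+1%:R + y)^-1 * connector n m.+1 =
  n%:R^-1 * connector n m - n%:R^-1 * connector n m.+1.
Proof.
move=> n0; have n0' : n%:R != 0 :> R by rewrite pnatr_eq0 -lt0n.
have m0 := lt0r_neq0 (natDy_gt0 (ltn0Sn m)).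
have -> : connector n m =
    connector n m.+1 * (n%:R + (m.+1%:R + y)) / (m.+1%:R + y).
  by rewrite connectorSr mulfK.
by move: m0; set a := m.+1%:R + y => a0; field; rewrite n0' a0.
Qed.

Lemma connector_diffl n m : (0 < m)%N ->
  n.+1%:R^-1 * connector n.+1 m =
  (m%:R + y)^-1 * connector n m - (m%:R + y)^-1 * connector n.+1 m.
Proof.
move=> m0; have m0' := lt0r_neq0 (natDy_gt0 m0).
have d1 := lt0r_neq0 (den_gt0 m (ltn0Sn n)).
have n0 : 1 + n%:R != 0 :> R by rewrite nat1r pnatr_eq0.
rewrite connectorSl; rewrite -nat1r in d1 *; by field; rewrite d1 m0' n0.
Qed.

Lemma connector_cvgr n : (0 < n)%N -> connector n m @[m --> \oo] --> 0.
Proof.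
case: n => // n _.
have lec k m : (0 < m)%N -> connector k m <= 1.
  move=> m0; rewrite /connector big_nat; apply: prodr_ile1 => j /andP[j0 _].
  rewrite divr_ge0 ?ler0n ?(ltW (den_gt0 m j0)) //=.
  by rewrite ler_pdivrMr ?den_gt0 // mul1r lerDl ltW ?natDy_gt0.
apply: (@squeeze_cvgr _ _ _ _ (fun=> 0) (fun m : nat => n.+1%:R * (m%:R)^-1)).
- near=> m; have m0 : (0 < m)%N by near: m; exact: nbhs_infty_gt.
  rewrite connector_ge0 /= connectorSl -[leRHS]mul1r ler_pM ?connector_ge0 ?lec //.
    by rewrite divr_ge0 ?ler0n // ltW ?den_gt0.
  rewrite ler_wpM2l ?ler0n // lef_pV2 ?posrE ?den_gt0 ?ltr0n //.
  rewrite -natr1; have := ler0n R n; move: y_gtN1; lra.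
- exact: cvg_cst.
- have -> : (0 : R) = n.+1%:R * 0 by rewrite mulr0.
  apply: cvgM; first exact: cvg_cst.
  by have := @cvg_harmonic R; rewrite (cvg_shiftS (fun m : nat => m%:R^-1 : R)).
Unshelve. all: by end_near. Qed.

(** [1 / connector n m = \prod_(j <= n) (1 + (m + y)/j)] dominates
    [(m + y) * \sum_(j <= n) 1/j]. *)
Lemma connector_cvgl m : (0 < m)%N -> connector n m @[n --> \oo] --> 0.
Proof.
move=> m0; have my := natDy_gt0 m0.
have inv_ge n : 1 + (m%:R + y) * series harmonic n <= (connector n m)^-1.
  elim: n => [|n IHn].
    by rewrite connector0 invr1 /series /= big_geq // mulr0 addr0.
  rewrite connectorSl invfM invf_div.
  have -> : (n.+1%:R + (m%:R + y)) / n.+1%:R = 1 + (m%:R + y) / n.+1%:R.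
    by rewrite [LHS]mulrDl divff ?pnatr_eq0.
  rewrite [leRHS]mulrDr mulr1.
  rewrite seriesSr mulrDr addrA lerD //= -[leLHS]mul1r ler_wpM2r //.
    by rewrite divr_ge0 ?ler0n ?(ltW my).
  rewrite (le_trans _ IHn) // lerDl mulr_ge0 ?(ltW my) //.
  by apply: sumr_ge0 => i _; exact: harmonic_ge0.
apply/cvgrVy; first by near=> n; exact: connector_gt0.
apply/cvgryPge => A.
have /cvgryPge/(_ (A / (m%:R + y))) : series (@harmonic R) @ \oo --> +oo.
  apply: nondecreasing_dvgn_lt; last exact: dvg_harmonic.
  by apply: nondecreasing_series => n _ _; exact: harmonic_ge0.
apply: filterS => n; rewrite ler_pdivrMr // mulrC => An.
apply: le_trans (inv_ge n); rewrite (le_trans An) //.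
by rewrite lerDr.
Unshelve. all: by end_near. Qed.

(** Telescoping by [connector_diffr]. This trades an entry 1 of the index summed
    with shift [y] for one more factor [1/n]. *)
Lemma esum_connectorr n m : (0 < n)%N ->
  \esum_(k in [set k | (m < k)%N]) ((k%:R + y)^-1 * connector n k)%:E =
  (n%:R^-1 * connector n m)%:E.
Proof.
move=> n0; apply: (esum_telescope (u := fun k => n%:R^-1 * connector n k)).
- by move=> k _; exact: connector_diffr.
- by move=> k mk; rewrite mulr_ge0 ?connector_ge0 // invr_ge0 ltW // natDy_gt0 //; lia.
- rewrite -[X in _ --> X](mulr0 n%:R^-1); apply: cvgM; first exact: cvg_cst.
  exact: connector_cvgr.
Qed.

(** Telescoping by [connector_diffl]. This trades a factor [1/(m + y)] for an
    entry 1 of the unshifted index. *)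
Lemma esum_connectorl n m : (0 < m)%N ->
  \esum_(k in [set k | (n < k)%N]) (k%:R^-1 * connector k m)%:E =
  ((m%:R + y)^-1 * connector n m)%:E.
Proof.
move=> m0; apply: (esum_telescope (u := fun k => (m%:R + y)^-1 * connector k m)).
- by move=> k _; exact: connector_diffl.
- by move=> k mk; rewrite mulr_ge0 ?connector_ge0 // invr_ge0 ler0n.
- rewrite -[X in _ --> X](mulr0 (m%:R + y)^-1); apply: cvgM; first exact: cvg_cst.
  exact: connector_cvgl.
Qed.

End Connector.

(** * Connected sums and duality *)

Section ConnectedSum.
Variables (R : realType) (y : R).
Hypothesis y_gtN1 : 0 < y + 1.

Definition connected_sum (k l : seq nat) : \bar R :=
  \esum_(M in increasing (size k)) \esum_(N in increasing (size l))
    (zeta_term y k M * zeta_term 0 l N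
     * connector y (last 0%N N) (last 0%N M))%:E.

Let connected_ge0 k l M N c : increasing (size k) M -> increasing (size l) N ->
  0 <= c -> 0 <= zeta_term y k M * zeta_term 0 l N * c.
Proof.
by move=> kM lN c0; rewrite !mulr_ge0 ?zeta_term_ge0 // add0r.
Qed.

(** Sum the last entry of [M] first, by [esum_connectorr]. *)
Lemma transport_one k l b :
  connected_sum (rcons k 1%N) (rcons l b) = connected_sum k (rcons l b.+1).
Proof.
rewrite /connected_sum !size_rcons esum_increasing_rcons; last first.
  move=> M kM; apply: esum_ge0 => N lN.
  by rewrite lee_fin connected_ge0 ?connector_ge0 ?size_rcons.
apply: eq_esum => M kM; rewrite esum_exchange; last first.
  move=> m N Mm lN.
  rewrite lee_fin connected_ge0 ?connector_ge0 ?size_rcons //.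
  exact/increasing_rcons.
apply: eq_esum => N lN; have N0 := increasing_last_gt0 lN.
case/lastP: N lN N0 => [//|N n] lN; rewrite last_rcons => n0.
have [lN' Nn] := (increasing_rcons _ _ _).1 lN.
have sM : size M = size k by case: kM.
have sN : size N = size l by case: lN'.
rewrite !zeta_term_rcons // addr0.
transitivity (\esum_(m in [set m | (last 0%N M < m)%N])
   ((zeta_term y k M * (zeta_term 0 l N * n%:R ^- b))%:E *
    ((m%:R + y)^-1 * connector y n m)%:E))%E.
  apply: eq_esum => m Mm; rewrite -EFinM zeta_term_rcons // last_rcons expr1.
  by congr (_%:E); ring.
rewrite esumZl; last 2 first.
- rewrite -[leRHS]mulr1; have := @connected_ge0 k (rcons l b) M (rcons N n) 1.
  by rewrite zeta_term_rcons // addr0; apply; rewrite ?size_rcons.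
- move=> m Mm; rewrite lee_fin mulr_ge0 ?connector_ge0 // invr_ge0.
  have m1 : 0 <= m%:R - 1 :> R by rewrite subr_ge0 ler1n; apply: leq_ltn_trans Mm.
  by move: y_gtN1; lra.
rewrite esum_connectorr // -EFinM; congr (_%:E).
rewrite exprSr invfM; ring.
Qed.

(** The last entry of [M] is positive, so the factor [1/(m + y)] can be expanded
    by [esum_connectorl]. *)
Lemma transport_succ k l a :
  connected_sum (rcons k a.+1) l = connected_sum (rcons k a) (rcons l 1%N).
Proof.
rewrite /connected_sum !size_rcons; apply: eq_esum => M kM.
rewrite [RHS]esum_increasing_rcons; last first.
  by move=> N lN; rewrite lee_fin connected_ge0 ?connector_ge0 ?size_rcons.
apply: eq_esum => N lN; have M0 := increasing_last_gt0 kM.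
case/lastP: M kM M0 => [//|M m] kM; rewrite last_rcons => m0.
have [kM' Mm] := (increasing_rcons _ _ _).1 kM.
have sM : size M = size k by case: kM'.
have sN : size N = size l by case: lN.
rewrite !zeta_term_rcons //.
transitivity (\esum_(n in [set n | (last 0%N N < n)%N])
   ((zeta_term y k M * (m%:R + y) ^- a * zeta_term 0 l N)%:E *
    (n%:R^-1 * connector y n m)%:E))%E; last first.
  apply: eq_esum => n Nn; rewrite -EFinM zeta_term_rcons // last_rcons expr1.
  by rewrite addr0; congr (_%:E); ring.
rewrite esumZl; last 2 first.
- rewrite -[leRHS]mulr1; have := @connected_ge0 (rcons k a) l (rcons M m) N 1.
  by rewrite zeta_term_rcons //; apply; rewrite ?size_rcons.
- by move=> n Nn; rewrite lee_fin mulr_ge0 ?connector_ge0 // invr_ge0 ler0n.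
rewrite esum_connectorl // -EFinM; congr (_%:E).
by rewrite exprSr invfM; ring.
Qed.

Lemma transport_succs k l a b :
  connected_sum (rcons k (b + a)%N) l = connected_sum (rcons k a) (l ++ nseq b 1%N).
Proof.
elim: b l => [|b IHb] l; first by rewrite cats0.
by rewrite addSn transport_succ IHb cat_rcons.
Qed.

Lemma transport_ones k l a b :
  connected_sum (k ++ nseq a 1%N) (rcons l b) = connected_sum k (rcons l (a + b)%N).
Proof.
elim: a b => [|a IHa] b; first by rewrite cats0.
by rewrite -addn1 nseqD catA cats1 transport_one IHa addnS addn1.
Qed.

(** The last block crosses over: [b + 1] units of its last exponent become
    entries 1, the remaining unit raises the last of these to 2, and the [a]
    entries 1 raise it further to [a + 2]. *)
Lemma transport_block k l a b :
  connected_sum (k ++ rcons (nseq a 1%N) (b + 2)%N) l =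
  connected_sum k (l ++ rcons (nseq b 1%N) (a + 2)%N).
Proof.
(* Keep the last exponent at 1 rather than 0, as [transport_one] needs. *)
rewrite -rcons_cat (_ : (b + 2 = b.+1 + 1)%N) ?addnS ?addn0 // -[b.+2]addn1.
rewrite transport_succs.
rewrite -[b.+1]addn1 nseqD /= catA cats1 transport_one.
by rewrite transport_ones rcons_cat addn2.
Qed.

(** Blocks cross over starting from the last one and are appended in the order
    of crossing, which is why duality reverses their order. *)
Lemma connected_sum_dual ab l :
  connected_sum (index_of_blocks ab) l =
  connected_sum [::] (l ++ index_of_blocks (rev [seq (c.2, c.1) | c <- ab])).
Proof.
elim/last_ind: ab l => [|ab [a b] IHab] l; first by rewrite cats0.
rewrite {1}/index_of_blocks map_rcons flatten_rcons transport_block IHab.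
by rewrite map_rcons rev_rcons /index_of_blocks /= catA.
Qed.

Lemma connected_sum_nilr k : connected_sum k [::] = mzeta k y.
Proof.
apply: eq_esum => M kM; rewrite increasing0 esum_set1; last first.
  by rewrite lee_fin connected_ge0 ?connector_ge0 // increasing0.
by rewrite /= connector0 mulr1 {2}/zeta_term big_ord0 mulr1.
Qed.

Lemma connected_sum_nill l : connected_sum [::] l =
  \esum_(N in increasing (size l))
    (zeta_term 0 l N * connector y (last 0%N N) 0)%:E.
Proof.
rewrite /connected_sum increasing0 esum_set1; last first.
  apply: esum_ge0 => N lN.
  by rewrite lee_fin connected_ge0 ?connector_ge0 // increasing0.
by apply: eq_esum => N lN; rewrite {1}/zeta_term big_ord0 mul1r.
Qed.

Lemma mzeta_dual s t : dual_index s t ->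
  mzeta s y = \esum_(N in increasing (size t))
    (zeta_term 0 t N * connector y (last 0%N N) 0)%:E.
Proof.
case=> ab [-> ->].
by rewrite -connected_sum_nilr connected_sum_dual cat0s connected_sum_nill.
Qed.

End ConnectedSum.

(** * Convergence of multiple zeta series *)

Section Finiteness.
Variable R : realType.

Lemma increasing_nth_gt0 q n i : increasing q n -> (i < q)%N ->
  (0 < nth 0%N n i)%N.
Proof.
move=> [<-] /(order_path_min ltn_trans)/allP n0 iq.
by apply: n0; rewrite mem_nth.
Qed.

(** For [k >= 1] and [c = min(1, y + 1)] one has [c * k <= k + y], so that
    shifting costs only a constant factor. *)
Lemma zeta_term_le (y : R) (s t : seq nat) n : 0 < y + 1 ->
  size t = size s -> increasing (size s) n ->
  (forall i, (i < size s)%N -> (nth 0%N t i <= nth 0%N s i)%N) ->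
  zeta_term y s n <=
  \prod_(i < size s) Num.min 1 (y + 1) ^- nth 0%N s i * zeta_term 0 t n.
Proof.
move=> y1 ts sn le_ts; rewrite /zeta_term ts -big_split /=.
set c := Num.min 1 _; have c0 : 0 < c by rewrite lt_min ltr01 y1.
apply: ler_prod => i _; have ni := increasing_nth_gt0 sn (ltn_ord i).
set k := nth 0%N n i in ni *; set a := nth 0%N s i; set b := nth 0%N t i.
have k1 : 1 <= k%:R :> R by rewrite ler1n.
have cky : c * k%:R <= k%:R + y.
  have [c1 cy] : c <= 1 /\ c <= y + 1 by split; rewrite ge_min lexx ?orbT.
  rewrite -subr_ge0.
  (* Both summands are nonnegative, since [c <= 1 <= k] and [c <= y + 1]. *)
  have -> : k%:R + y - c * k%:R = (1 - c) * (k%:R - 1) + (y + 1 - c) by ring.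
  by rewrite addr_ge0 ?mulr_ge0 ?subr_ge0.
have ck0 : 0 < c * k%:R by rewrite mulr_gt0 // ltr0n.
have ky0 : 0 < k%:R + y := lt_le_trans ck0 cky.
rewrite invr_ge0 exprn_ge0 ?(ltW ky0) //= addr0.
rewrite -invfM lef_pV2 ?posrE ?mulr_gt0 ?exprn_gt0 ?ltr0n //.
apply: (@le_trans _ _ ((c * k%:R) ^+ a)); last first.
  by apply: lerXn2r => //; rewrite nnegrE ltW.
rewrite exprMn ler_wpM2l ?exprn_ge0 ?(ltW c0) // ler_weXn2l //.
by apply: le_ts; exact: ltn_ord.
Qed.

(** The dual index is the single entry [p + 2], and at [y = 0] the connector
    with [m = 0] is 1; the series is dominated by [\sum_k 2 / (k (k + 1))], which
    is again a connector sum. *)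
Lemma mzeta_ones2_lty p : (mzeta (rcons (nseq p 1%N) 2%N) (0 : R) < +oo)%E.
Proof.
have y0 : (0 : R) < 0 + 1 by rewrite add0r.
have /(mzeta_dual y0) -> : dual_index (rcons (nseq p 1%N) 2%N) [:: p.+2].
  by exists [:: (p, 0%N)]; rewrite /index_of_blocks /= cats0 !addn2.
rewrite esum_increasing_rcons; last first.
  move=> N pN; rewrite lee_fin mulr_ge0 ?connector_ge0 ?zeta_term_ge0 //.
rewrite increasing0 esum_set1; last first.
  apply: esum_ge0 => k k0; rewrite lee_fin mulr_ge0 ?connector_ge0 //.
  by apply: zeta_term_ge0 => //; apply/(increasing_rcons 0 [::] k).
apply: (@le_lt_trans _ _ (\esum_(k in [set k | (0 < k)%N])
    (2%:E * (k%:R^-1 * connector (0 : R) k 1)%:E))%E).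
  apply: le_esum => k /= k0; rewrite -EFinM lee_fin.
  rewrite -[[:: p.+2]]/(rcons [::] p.+2) -[[:: k]]/(rcons [::] k).
  rewrite zeta_term_rcons // /zeta_term big_ord0 mul1r addr0.
  have k1 : 1 <= k%:R :> R by rewrite ler1n.
  have c1 : connector (0 : R) k 0 = 1.
    rewrite /connector big_nat big1 // => j /andP[j0 _].
    by rewrite !addr0 divff // pnatr_eq0 -lt0n.
  have := connectorSr y0 k 0; rewrite c1 !addr0 mul1r => ck1.
  have -> : connector (0 : R) k 1 = (k%:R + 1)^-1.
    by apply: (mulIf (_ : k%:R + 1 != 0 :> R)); rewrite ?mulVf ?ck1 // natr1 pnatr_eq0.
  rewrite mulr1 mulrCA exprS invfM ler_wpM2l ?invr_ge0 ?ler0n //.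
  apply: (@le_trans _ _ k%:R^-1); last first.
    by rewrite ler_pdivlMr ?ler_pdivrMl ?ltr0n // ?natr1 ?ltr0n //; nra.
  by rewrite lef_pV2 ?posrE ?exprn_gt0 ?ltr0n // -[leLHS]expr1 ler_weXn2l.
rewrite esumZl //; last first.
  by move=> k k0; rewrite lee_fin mulr_ge0 ?connector_ge0 ?invr_ge0 ?ler0n.
by rewrite esum_connectorl // -EFinM ltry.
Qed.

Lemma mzeta_lty (s : seq nat) (b : nat) (y : R) : 0 < y + 1 ->
  all (fun a => 0 < a)%N s -> (1 < b)%N -> (mzeta (rcons s b) y < +oo)%E.
Proof.
move=> y1 /allP s0 b1; set t := rcons (nseq (size s) 1%N) 2%N.
have ts : size t = size (rcons s b) by rewrite !size_rcons size_nseq.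
set C := \prod_(i < size (rcons s b)) Num.min 1 (y + 1) ^- nth 0%N (rcons s b) i.
have C0 : 0 <= C.
  by apply: prodr_ge0 => i _; rewrite invr_ge0 exprn_ge0 // le_min ler01 ltW.
apply: (@le_lt_trans _ _ (C%:E * mzeta t 0)%E); last first.
  by apply: lte_mul_pinfty; rewrite ?lee_fin ?mzeta_ones2_lty.
have z0 : (0 : R) < 0 + 1 by rewrite add0r.
rewrite /mzeta ts -esumZl //; last first.
  by move=> n sn; rewrite lee_fin -ts; apply: zeta_term_ge0; rewrite ?ts.
apply: le_esum => n sn; rewrite -EFinM lee_fin.
have := @zeta_term_le y _ _ _ y1 ts sn; rewrite -/C /zeta_term ts; apply => i.
rewrite size_rcons ltnS => si; rewrite !nth_rcons size_nseq nth_nseq.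
case: ltngtP si => // si _; first by rewrite s0 // mem_nth.
Qed.

End Finiteness.

(** * Power series with nonnegative coefficients *)

Section PowerSeries.
Variable R : realType.
Implicit Types (a b : nat -> R) (z u v w t : R).

(** Only used with nonnegative coefficients, where the value is +oo on divergence
    and rearrangements cost nothing. *)
Definition pser a z : \bar R := \esum_(k in setT) (a k * z ^+ k)%:E.

Lemma pserZ a z c : 0 <= c -> 0 <= z -> (forall k, 0 <= a k) ->
  pser (fun k => c * a k) z = (c%:E * pser a z)%E.
Proof.
move=> c0 z0 a0; rewrite -esumZl // => [|k _].
  by apply: eq_esum => k _; rewrite -EFinM mulrA.
by rewrite lee_fin mulr_ge0 // exprn_ge0.
Qed.

(** Cauchy product: the pairs [(m, i)] with [i <= m] are reindexed by
    [(i, m - i)]. *)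
Lemma pserM a b z u v : 0 <= z -> (forall k, 0 <= a k) -> (forall k, 0 <= b k) ->
  pser a z = u%:E -> pser b z = v%:E ->
  pser (fun m => \sum_(i < m.+1) a i * b (m - i)%N) z = (u * v)%:E.
Proof.
move=> z0 a0 b0 au bv.
have az k : (0 <= (a k * z ^+ k)%:E)%E by rewrite lee_fin mulr_ge0 ?exprn_ge0.
have bz k : (0 <= (b k * z ^+ k)%:E)%E by rewrite lee_fin mulr_ge0 ?exprn_ge0.
have v0 : 0 <= v by rewrite -lee_fin -bv; apply: esum_ge0.
have F0 i j : (0 <= (a i * z ^+ i)%:E * (b j * z ^+ j)%:E)%E by rewrite mule_ge0.
transitivity (\esum_(m in setT) \esum_(i in [set i | (i < m.+1)%N])
    ((a i * z ^+ i)%:E * (b (m - i)%N * z ^+ (m - i))%:E))%E.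
  apply: eq_esum => m _.
  transitivity (\sum_(i \in `I_m.+1)
      ((a i * z ^+ i)%:E * (b (m - i)%N * z ^+ (m - i))%:E))%E; last first.
    by rewrite esum_fset //; exact: finite_II.
  rewrite -fsbig_ord /= mulr_suml -sumEFin; apply: eq_bigr => i _.
  by rewrite -EFinM mulrACA -exprD subnKC // -ltnS.
rewrite esum_esum; last by move=> i j _ _; exact: F0.
rewrite (reindex_esum (setT `*`` fun=> setT) _ (fun p => (p.1 + p.2, p.1)%N)) /=.
  rewrite -(@esum_esum _ _ _ setT (fun=> setT)
    (fun i j => (a i * z ^+ i)%:E * (b (i + j - i)%N * z ^+ (i + j - i))%:E)%E);
    last by move=> *; exact: F0.
  transitivity (\esum_(i in setT) (v%:E * (a i * z ^+ i)%:E))%E.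
    apply: eq_esum => i _; rewrite muleC -bv -esumZl //; last first.
      by rewrite mulr_ge0 ?exprn_ge0.
    by apply: eq_esum => j _; rewrite addKn.
  by rewrite esumZl // -/(pser a z) au -EFinM mulrC.
split.
- by move=> [i j] _ /=; split => //; rewrite ltnS leq_addr.
- by move=> [i j] [i' j'] _ _ /= [] e ei; congr (_, _); lia.
- move=> [m i] [_ /=]; rewrite ltnS => im.
  by exists (i, (m - i)%N) => //=; rewrite subnKC.
Qed.

Lemma pser1 z : pser (fun k => (k == 0%N)%:R) z = 1%:E.
Proof.
rewrite /pser (esumID [set 0%N]); last first.
  by move=> [|k] _; rewrite ?mul0r ?expr0 ?mulr1 lee_fin.
rewrite setTI esum_set1 ?mul1r ?expr0 ?lee_fin // esum1 ?adde0 //.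
by move=> [|k] [_ k0] /=; rewrite ?mul0r //; case: k0.
Qed.

Lemma pser_geometric t z : 0 <= t -> 0 <= z -> t * z < 1 ->
  pser (fun k => t ^+ k) z = ((1 - t * z)^-1)%:E.
Proof.
move=> t0 z0 tz1; have tz0 : 0 <= t * z by rewrite mulr_ge0.
rewrite /pser -nneseries_esumT; last first.
  by move=> k; rewrite lee_fin mulr_ge0 ?exprn_ge0.
apply/cvg_lim => //.
rewrite (_ : (fun n => _) = EFin \o series (geometric 1 (t * z))); last first.
  apply/funext => n /=; rewrite sumEFin; congr (_%:E).
  by apply: eq_bigr => k _; rewrite /= mul1r exprMn.
apply: cvg_EFin; first exact: nearW.
rewrite -[X in _ --> X]mul1r; apply: cvg_geometric_series.
by rewrite ger0_norm.
Qed.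

(** Multiplying by the geometric series sums the binomial coefficients along a
    diagonal of Pascal's triangle. *)
Lemma pser_binomial s t z : 0 <= t -> 0 <= z -> t * z < 1 ->
  pser (fun k => 'C(s + k - 1, k)%:R * t ^+ k) z = ((1 - t * z) ^- s)%:E.
Proof.
move=> t0 z0 tz1; elim: s => [|s IHs].
  rewrite expr0 invr1 -(pser1 z); apply: eq_esum => -[|k] _.
    by rewrite bin0 !expr0 !mulr1.
  by rewrite add0n subn1 /= bin_small // mul0r.
rewrite exprS invfM -(pserM z0 _ _ (pser_geometric t0 z0 tz1) IHs); last 2 first.
- by move=> k; rewrite exprn_ge0.
- by move=> k; rewrite mulr_ge0 ?exprn_ge0 ?ler0n.
apply: eq_esum => k _; congr ((_ * _)%:E).
rewrite (reindex_inj rev_ord_inj) /=.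
under eq_bigr => i _.
  rewrite subSS subKn; last exact: leq_ord.
  rewrite mulrCA -exprD subnK; last exact: leq_ord.
  over.
rewrite -mulr_suml -natr_sum; congr (_%:R * _).
rewrite addSn subn1 /=; elim: k => [|k IHk]; first by rewrite big_ord1 !bin0.
by rewrite big_ord_recr /= -IHk !addnS binS subn1 addnC.
Qed.

Lemma convolution_ge0 (a : nat -> nat -> R) q m :
  (forall i k, (i < q)%N -> 0 <= a i k) -> 0 <= convolution a q m.
Proof.
elim: q m => [|q IHq] m a0; first exact: ler0n.
rewrite convolutionS sumr_ge0 // => i _; rewrite mulr_ge0 ?a0 //.
by apply: IHq => j k jq; rewrite a0 // ltnW.
Qed.

Lemma pser_convolution (a : nat -> nat -> R) (v : nat -> R) q z : 0 <= z ->
  (forall i k, (i < q)%N -> 0 <= a i k) ->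
  (forall i, (i < q)%N -> pser (a i) z = (v i)%:E) ->
  pser (convolution a q) z = (\prod_(i < q) v i)%:E.
Proof.
move=> z0; elim: q => [|q IHq] a0 av.
  by rewrite big_ord0; exact: pser1.
rewrite big_ord_recr /= mulrC.
have a0' i k : (i < q)%N -> 0 <= a i k by move=> iq; rewrite a0 // ltnW.
apply: (pserM z0) => [k|k||]; [exact: a0|exact: convolution_ge0|exact: av|].
by apply: IHq => // i iq; rewrite av // ltnW.
Qed.

Lemma pser_recl a z : 0 <= z -> (forall k, 0 <= a k) ->
  pser a z = ((a 0)%:E + z%:E * pser (fun k => a k.+1) z)%E.
Proof.
move=> z0 a0; have az k : (0 <= (a k * z ^+ k)%:E)%E.
  by rewrite lee_fin mulr_ge0 ?exprn_ge0.
rewrite {1}/pser (esumID [set 0%N]) // setTI esum_set1 // expr0 mulr1.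
congr (_ + _)%E; rewrite -esumZl // => [|k _]; last first.
  by rewrite lee_fin mulr_ge0 ?exprn_ge0.
rewrite setTI (reindex_esum setT _ S); first last.
  split=> [k _ //|j k _ _ [] //|[|k] k0]; [by case: k0|].
  by exists k.
by apply: eq_esum => k _; rewrite -EFinM exprS mulrCA.
Qed.

Lemma le_pser a z w : 0 <= z -> z <= w -> (forall k, 0 <= a k) ->
  (pser a z <= pser a w)%E.
Proof.
move=> z0 zw a0; apply: le_esum => k _.
by rewrite lee_fin ler_wpM2l // lerXn2r ?nnegrE // (le_trans z0).
Qed.

(** As [z] tends to 0 only the constant terms remain: for [0 < z <= w] the rest
    of the right-hand side is at most [z] times a fixed finite value. *)
Let pser_le_head a b (e : R) : 0 < e ->
  (forall k, 0 <= a k) -> (forall k, 0 <= b k) ->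
  (forall z, 0 < z -> z < e -> pser a z = pser b z /\ (pser a z < +oo)%E) ->
  a 0%N <= b 0%N.
Proof.
move=> e0 a0 b0 ab; have [w [w0 we]] : exists w, 0 < w /\ w < e.
  by exists (e / 2); rewrite divr_gt0 // ltr_pdivrMr // ltr_pMr // ltr1n.
pose T := pser (fun k => b k.+1) w.
have T0 : (0 <= T)%E.
  by apply: esum_ge0 => j _; rewrite lee_fin mulr_ge0 // exprn_ge0 // ltW.
have [tt Tfin] : exists tt, T = tt%:E.
  have [abw] := ab w w0 we; rewrite abw pser_recl ?(ltW w0) // -/T.
  case: T T0 => [r _ _|_|//]; first by exists r.
  by rewrite gt0_muley ?lte_fin // addey.
have tt0 : 0 <= tt by rewrite -lee_fin -Tfin.
apply/ler_addgt0Pr => _/posnumP[eps].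
(* The second bound gives [z * tt <= eps]. *)
pose z := Num.min w (eps%:num / (tt + 1)).
have tt1 : 0 < tt + 1 by rewrite ltr_wpDl.
have z0 : 0 < z by rewrite lt_min w0 divr_gt0.
have zw : z <= w by rewrite ge_min lexx.
have [abz _] := ab z z0 (le_lt_trans zw we).
have : ((a 0%N)%:E <= (b 0%N)%:E + z%:E * T)%E.
  apply: (@le_trans _ _ (pser a z)).
    rewrite pser_recl ?(ltW z0) // leeDl // mule_ge0 ?lee_fin ?(ltW z0) //.
    by apply: esum_ge0 => j _; rewrite lee_fin mulr_ge0 // exprn_ge0 // ltW.
  rewrite abz pser_recl ?(ltW z0) // leeD2l // lee_wpmul2l ?lee_fin ?(ltW z0) //.
  by apply: le_pser; rewrite ?(ltW z0).
rewrite Tfin -EFinM -EFinD lee_fin => /le_trans; apply.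
rewrite lerD2l (@le_trans _ _ (eps%:num / (tt + 1) * tt)) //.
  by rewrite ler_wpM2r // ge_min lexx orbT.
by rewrite mulrAC ler_pdivrMr // ler_wpM2l // lerDl.
Qed.

(** Once the constant terms agree, they cancel and [z] can be divided out. *)
Lemma pser_inj a b (e : R) : 0 < e ->
  (forall k, 0 <= a k) -> (forall k, 0 <= b k) ->
  (forall z, 0 < z -> z < e -> pser a z = pser b z /\ (pser a z < +oo)%E) ->
  a =1 b.
Proof.
move=> e0 a0 b0 ab k; elim: k a b a0 b0 ab => [|k IHk] a b a0 b0 ab.
  apply/eqP; rewrite eq_le !(pser_le_head e0) // => z z0 ze.
  by have [<-] := ab z z0 ze.
have ab0 : a 0%N = b 0%N.
  apply/eqP; rewrite eq_le !(pser_le_head e0) // => z z0 ze.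
  by have [<-] := ab z z0 ze.
apply: (IHk (fun k => a k.+1) (fun k => b k.+1)) => // z z0 ze.
have [] := ab z z0 ze; rewrite (pser_recl (ltW z0) a0) (pser_recl (ltW z0) b0).
rewrite ab0; have gez (c : nat -> R) : (forall j, 0 <= c j) ->
    (0 <= pser (fun j => c j.+1) z)%E.
  by move=> c0; apply: esum_ge0 => j _; rewrite lee_fin mulr_ge0 // exprn_ge0 // ltW.
move: (gez a a0) (gez b b0).
case: (pser _ z) => [u _||//]; case: (pser _ z) => [v _||//] //.
- rewrite -!EFinM -!EFinD => -[/addrI/(mulfI (lt0r_neq0 z0)) -> _].
  by rewrite ltry.
- by rewrite gt0_muley ?lte_fin.
- by rewrite gt0_muley ?lte_fin.
- by rewrite gt0_muley ?lte_fin.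
Qed.

End PowerSeries.

(** * Extraction of the coefficients in the shift *)

Section CoefficientExtraction.
Variable R : realType.

Lemma pser_esum (T : choiceType) (I : set T) (A : T -> nat -> R) (z : R) :
  0 <= z -> (forall i m, I i -> 0 <= A i m) ->
  \esum_(m in setT) ((z ^+ m)%:E * \esum_(i in I) (A i m)%:E)%E =
  \esum_(i in I) pser (A i) z.
Proof.
move=> z0 A0; rewrite [RHS]esum_exchange; last first.
  by move=> i m Ii _; rewrite lee_fin mulr_ge0 ?A0 ?exprn_ge0.
apply: eq_esum => m _; rewrite -esumZl ?exprn_ge0 //; last first.
  by move=> i Ii; rewrite lee_fin A0.
by apply: eq_esum => i _; rewrite -EFinM mulrC.
Qed.

(** Extraction of coefficients from sums of power series. Finiteness at one
    point makes every coefficient finite, so that [pser_inj] applies. *)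
Lemma esum_coef_inj (T T' : choiceType) (I : set T) (J : set T')
    (A : T -> nat -> R) (B : T' -> nat -> R) (e : R) : 0 < e ->
  (forall i m, I i -> 0 <= A i m) -> (forall j m, J j -> 0 <= B j m) ->
  (forall z, 0 < z -> z < e ->
     \esum_(i in I) pser (A i) z = \esum_(j in J) pser (B j) z /\
     (\esum_(i in I) pser (A i) z < +oo)%E) ->
  forall m, \esum_(i in I) (A i m)%:E = \esum_(j in J) (B j m)%:E /\
    \esum_(i in I) (A i m)%:E \is a fin_num.
Proof.
move=> e0 A0 B0 AB.
have fin_coef (U : choiceType) (K : set U) (C : U -> nat -> R) :
    (forall i m, K i -> 0 <= C i m) ->
    (forall z, 0 < z -> z < e -> (\esum_(i in K) pser (C i) z < +oo)%E) ->
    exists c : nat -> R, [/\ forall m, 0 <= c m,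
      forall m, \esum_(i in K) (C i m)%:E = (c m)%:E &
      forall z, 0 < z -> \esum_(i in K) pser (C i) z = pser c z].
  move=> C0 Cfin; pose S m := \esum_(i in K) (C i m)%:E.
  have S0 m : (0 <= S m)%E by apply: esum_ge0 => i Ki; rewrite lee_fin C0.
  have Sfin m : S m = (fine (S m))%:E.
    have [w [w0 we]] : exists w, 0 < w /\ w < e.
      by exists (e / 2); rewrite divr_gt0 // ltr_pdivrMr // ltr_pMr // ltr1n.
    have := Cfin w w0 we; rewrite -pser_esum ?ltW //.
    have le_m : ((w ^+ m)%:E * S m <=
        \esum_(m in setT) ((w ^+ m)%:E * \esum_(i in K) (C i m)%:E))%E.
      rewrite (esumID [set m]) ?setTI ?esum_set1 ?leeDl ?esum_ge0 // => *;
        by rewrite mule_ge0 ?lee_fin ?exprn_ge0 ?(ltW w0) ?S0.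
    move=> /(le_lt_trans le_m); move: (S0 m); case: (S m) => // _.
    by rewrite gt0_muley ?lte_fin ?exprn_gt0.
  exists (fine \o S); split=> [m|m|z z0]; first by rewrite /= fine_ge0.
    by rewrite -Sfin.
  rewrite -pser_esum ?ltW //; apply: eq_esum => m _.
  by rewrite -/(S m) Sfin -EFinM mulrC.
have [a [a0 aA az]] := fin_coef _ _ _ A0 (fun z z0 ze => (AB z z0 ze).2).
have Bfin z (z0 : 0 < z) (ze : z < e) : (\esum_(j in J) pser (B j) z < +oo)%E.
  by have [<-] := AB z z0 ze.
have [b [b0 bB bz]] := fin_coef _ _ _ B0 Bfin.
have ab : a =1 b.
  apply: (pser_inj e0) => // z z0 ze; have [] := AB z z0 ze.
  by rewrite az // bz.
by move=> m; rewrite aA bB ab.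
Qed.

End CoefficientExtraction.

Section ShiftedSeries.
Variables (R : realType) (x : R).
Hypothesis x_gtN1 : 0 < x + 1.

Let base_gt0 (n : nat) (z : R) : (0 < n)%N -> z < x + 1 -> 0 < n%:R + x - z.
Proof.
by case: n => // n _ zx; rewrite -natr1; have := ler0n R n; lra.
Qed.

Let ratio_lt1 (n : nat) (z : R) : (0 < n)%N -> z < x + 1 ->
  (n%:R + x)^-1 * z < 1.
Proof.
move=> n0 zx; have := base_gt0 n0 x_gtN1; rewrite subr0 => nx0.
by rewrite ltr_pdivrMl // mulr1 -subr_gt0 base_gt0.
Qed.

(** Factor by factor,
    [j / (j + x) * (1 - z / (j + x))^-1 = j / (j + x - z)]. *)
Lemma pser_connector (n : nat) (z : R) : 0 <= z -> z < x + 1 ->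
  pser (fun m => connector x n 0 *
                 complete_sym (fun j => (j%:R + x)^-1) n m) z =
  (connector (x - z) n 0)%:E.
Proof.
move=> z0 zx.
have nx0 k : (0 < k)%N -> 0 < k%:R + x.
  by move=> k0; have := base_gt0 k0 x_gtN1; rewrite subr0.
have t0 k : 0 <= (k.+1%:R + x)^-1 by rewrite invr_ge0 ltW ?nx0.
rewrite pserZ ?connector_ge0 //; last first.
  by move=> m; apply: convolution_ge0 => i k _; rewrite exprn_ge0.
rewrite (@pser_convolution _ _ (fun i => (1 - (i.+1%:R + x)^-1 * z)^-1)) //.
- rewrite -EFinM; congr (_%:E).
  rewrite /connector !big_add1 /= !big_mkord -big_split /=.
  apply: eq_bigr => i _; rewrite !add0r.
  have a0 := lt0r_neq0 (nx0 i.+1 (ltn0Sn i)).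
  have b0 := lt0r_neq0 (base_gt0 (ltn0Sn i) zx).
  rewrite addrA -mulrA -invfM mulrBr mulr1 mulrA divff // mul1r.
  by [].
- by move=> i k _; rewrite exprn_ge0.
- by move=> i _; rewrite pser_geometric // ratio_lt1.
Qed.

(** The coefficient of [z ^ k] in [(n_i + x - z) ^- s_i]. *)
Definition shift_coef (s n : seq nat) (i k : nat) : R :=
  'C(nth 0%N s i + k - 1, k)%:R * ((nth 0%N n i)%:R + x) ^- (nth 0%N s i + k).

Lemma shift_coef_ge0 s n i k : increasing (size s) n -> (i < size s)%N ->
  0 <= shift_coef s n i k.
Proof.
move=> sn si; rewrite mulr_ge0 // invr_ge0 exprn_ge0 // ltW //.
by rewrite -[_ + x]subr0 base_gt0 // (increasing_nth_gt0 sn).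
Qed.

Lemma pser_zeta_term (s n : seq nat) (z : R) :
  increasing (size s) n -> 0 <= z -> z < x + 1 ->
  pser (convolution (shift_coef s n) (size s)) z = (zeta_term (x - z) s n)%:E.
Proof.
move=> sn z0 zx; rewrite /zeta_term.
apply: (pser_convolution
  (v := fun i => ((nth 0%N n i)%:R + (x - z)) ^- nth 0%N s i)) => //.
  by move=> i k; exact: shift_coef_ge0.
move=> i si; have ni := increasing_nth_gt0 sn si.
rewrite /shift_coef; set w := _ + x; set a := nth 0%N s i.
have w0 : 0 < w by rewrite -[w]subr0 base_gt0.
rewrite [LHS](_ : _ = pser (fun k => w ^- a * ('C(a + k - 1, k)%:R * w^-1 ^+ k)) z); last first.
  by apply: eq_esum => k _; rewrite exprVn mulrCA -invfM -exprD.
rewrite pserZ ?invr_ge0 ?exprn_ge0 ?(ltW w0) //; last first.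
  by move=> k; rewrite mulr_ge0 // exprn_ge0 // invr_ge0 ltW.
rewrite pser_binomial ?invr_ge0 ?(ltW w0) ?ratio_lt1 //.
rewrite -EFinM -!exprVn -exprMn -invfM mulrBr mulr1 mulrA divff ?gt_eqF //.
by rewrite mul1r addrA exprVn.
Qed.

(** [mzeta_dual] holds at [y = x - z] for every [z] in [0, x + 1[; the two sides
    are the coefficients of [z ^ m] in it. *)
Lemma mzeta_dual_coef (s t : seq nat) (b m : nat) :
  all (fun a => 0 < a)%N s -> (1 < b)%N -> dual_index (rcons s b) t ->
  let lhs := \esum_(N in increasing (size t))
    (zeta_term 0 t N * (connector x (last 0%N N) 0 *
      complete_sym (fun j => (j%:R + x)^-1) (last 0%N N) m))%:E in
  lhs = \esum_(n in increasing (size s).+1)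
    (convolution (shift_coef (rcons s b) n) (size s).+1 m)%:E
  /\ lhs \is a fin_num.
Proof.
move=> s0 b1 st /=.
have h0 n k : 0 <= complete_sym (fun j => (j%:R + x)^-1) n k.
  apply: convolution_ge0 => i l _; rewrite exprn_ge0 // invr_ge0 ltW //.
  by rewrite -[_ + x]subr0 base_gt0.
have sb : size (rcons s b) = (size s).+1 by rewrite size_rcons.
apply: (esum_coef_inj (A := fun N m => zeta_term 0 t N * (connector x (last 0%N N) 0 *
      complete_sym (fun j => (j%:R + x)^-1) (last 0%N N) m))
  (B := fun n => convolution (shift_coef (rcons s b) n) (size s).+1) x_gtN1).
- move=> N k tN; rewrite mulr_ge0 ?zeta_term_ge0 ?mulr_ge0 ?connector_ge0 //.
- move=> n k sn; apply: convolution_ge0 => i l si.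
  by apply: shift_coef_ge0; rewrite sb.
move=> z z0 zx; have xz : 0 < x - z + 1 by lra.
have -> : \esum_(n in increasing (size s).+1)
    pser (convolution (shift_coef (rcons s b) n) (size s).+1) z =
    mzeta (rcons s b) (x - z).
  rewrite -sb; apply: eq_esum => n sn.
  by rewrite pser_zeta_term ?(ltW z0).
have -> : \esum_(N in increasing (size t)) pser (fun k => zeta_term 0 t N *
      (connector x (last 0%N N) 0 *
       complete_sym (fun j => (j%:R + x)^-1) (last 0%N N) k)) z =
    mzeta (rcons s b) (x - z).
  rewrite (mzeta_dual xz st); apply: eq_esum => N tN.
  rewrite pserZ ?zeta_term_ge0 ?add0r ?(ltW z0) //; last first.
    by move=> k; rewrite mulr_ge0 ?connector_ge0.
  by rewrite pser_connector ?(ltW z0).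
by split => //; exact: mzeta_lty.
Qed.

End ShiftedSeries.

Lemma incr_last_rcons (s : seq nat) a : incr_last (rcons s a) = rcons s a.+1.
Proof.
rewrite /incr_last size_rcons /=; elim: s => //= c s IHs.
by rewrite IHs.
Qed.

Lemma size_incr_last (s : seq nat) : (0 < size s)%N ->
  size (incr_last s) = size s.
Proof. by case/lastP: s => // s a _; rewrite incr_last_rcons !size_rcons. Qed.

Lemma zeta_term_incr_last (R : realType) (s n : seq nat) : (0 < size s)%N ->
  increasing (size s) n ->
  zeta_term (0 : R) (incr_last s) n =
  (\prod_(i < size s) (nth 0%N n i)%:R ^+ nth 0%N s i)^-1 / (last 0%N n)%:R.
Proof.
have -> : (\prod_(i < size s) (nth 0%N n i)%:R ^+ nth 0%N s i)^-1 =
    zeta_term (0 : R) s n.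
  by rewrite -prodfV; apply: eq_bigr => i _; rewrite addr0.
case/lastP: s => // s a _; rewrite size_rcons.
case/lastP: n => [[]//|n k] /increasing_rcons[[sn _] _].
by rewrite incr_last_rcons !zeta_term_rcons // last_rcons addr0 exprSr invfM mulrA.
Qed.

Lemma euler_beta_connector (R : realType) (x : R) (n : nat) : 0 < x + 1 ->
  (0 < n)%N -> n%:R * euler_beta n%:R (1 + x) = connector x n 0.
Proof.
move=> x1 n0; rewrite euler_beta_nat //; last by rewrite addrC.
rewrite mulrA -natrM -{1}(prednK n0) -factS prednK //.
rewrite /connector big_add1 big_mkord big_split /= prodfV; congr (_ / _).
  by rewrite -natr_prod fact_prod big_add1 big_mkord.
by apply: eq_bigr => j _; rewrite add0r -nat1r addrAC.
Qed.

Theorem theorem3 (R : realType) (q r : nat)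
    (alpha : q.-tuple nat) (beta : r.-tuple nat)
    (q_gt0 : (0 < q)%N) (r_gt0 : (0 < r)%N)
    (alpha_gt0 : forall i : 'I_q, (0 < tnth alpha i)%N)
    (beta_gt0 : forall i : 'I_r, (0 < tnth beta i)%N)
    (weight : (\sum_(i < q) tnth alpha i + 1 = q + r)%N)
    (dual : dual_index (incr_last alpha) (incr_last beta))
    (m : nat) (x : R) (x_gtN1 : 0 < x + 1) :
  let lhs : \bar R :=
    \esum_(n in increasing r)
      (euler_beta (last 0%N n)%:R (1 + x)
       * (bell_poly m (fun k => harmonic_sum k (last 0%N n) x)
          / \prod_(i < r) (nth 0%N n i)%:R ^+ tnth beta i))%:E in
  let rhs : \bar R :=
    (\sum_(d : q.-tuple 'I_m.+1 | (\sum_(i < q) tnth d i)%N == m)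
      let d' : seq nat := [seq nat_of_ord k | k <- d] in
      let e : seq nat := [seq (tnth alpha i + tnth d i)%N | i <- enum 'I_q] in
      (Mcoef alpha d' * 'C(last 0%N alpha + last 0%N d', last 0%N d'))%N%:R%:E
      * mzeta (incr_last e) x)%E in
  lhs \is a fin_num /\ lhs = rhs.
Proof.
move=> lhs rhs; case: q => // q in alpha q_gt0 alpha_gt0 weight dual rhs *.
have [s [a [alphaE s0]]] : exists s a,
    tval alpha = rcons s a /\ all (fun c => 0 < c)%N s.
  have all0 : all (fun c => 0 < c)%N alpha.
    by apply/allP => c /tnthP[i ->].
  move: (size_tuple alpha) all0; case/lastP: (tval alpha) => // s a _.
  by rewrite all_rcons => /andP[_ s0]; exists s, a.
have ss : size s = q.
  by have := size_tuple alpha; rewrite alphaE size_rcons => -[].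
have a0 : (0 < a)%N.
  have := alpha_gt0 ord_max; rewrite (tnth_nth 0%N) alphaE /=.
  by rewrite nth_rcons ss ltnn eqxx.
rewrite alphaE incr_last_rcons in dual.
have tr : size (incr_last beta) = r by rewrite size_incr_last size_tuple.
have [] := @mzeta_dual_coef _ x x_gtN1 s _ a.+1 m s0 _ dual; first by [].
have <- : lhs = \esum_(N in increasing (size (incr_last beta)))
    (zeta_term 0 (incr_last beta) N * (connector x (last 0%N N) 0 *
      complete_sym (fun j => (j%:R + x)^-1) (last 0%N N) m))%:E.
  rewrite tr; apply: eq_esum => n rn; congr (_%:E).
  have n0 : (0 < last 0%N n)%N by move: rn; rewrite -(prednK r_gt0) => /increasing_last_gt0.
  rewrite -euler_beta_connector // zeta_term_incr_last ?size_tuple //.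
  rewrite -bell_poly_complete_sym -/(harmonic_sum _ _ _).
  have nN0 : (last 0%N n)%:R != 0 :> R by rewrite pnatr_eq0 -lt0n.
  have -> : \prod_(i < r) (nth 0%N n i)%:R ^+ nth 0%N beta i =
      \prod_(i < r) (nth 0%N n i)%:R ^+ tnth beta i :> R.
    by apply: eq_bigr => i _; rewrite (tnth_nth 0%N).
  by rewrite /harmonic_sum; set P := (\prod_(i < r) _)^-1; field.
move=> lhsE lhs_fin; split => //; rewrite lhsE ss.
under eq_esum do rewrite convolution_tuple -sumEFin.
rewrite esum_sum; last first.
  move=> n d qn _; rewrite lee_fin prodr_ge0 // => i _.
  by apply: shift_coef_ge0; rewrite ?size_rcons ?ss.
apply: eq_bigr => d dm.
set e := [seq (tnth alpha i + tnth d i)%N | i <- enum 'I_q.+1].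
have se : size e = q.+1 by rewrite size_map size_enum_ord.
have ne i : (i < q.+1)%N ->
    nth 0%N (incr_last e) i = (nth 0%N (rcons s a.+1) i + nth 0%N (map val d) i)%N.
  move=> iq; rewrite -incr_last_rcons -alphaE /incr_last !nth_incr_nth.
  rewrite size_tuple se -addnA; congr (_ + _)%N.
  rewrite (nth_map (Ordinal iq)) ?size_enum_ord // -[i in nth _ _ i]/(val (Ordinal iq)).
  rewrite nth_ord_enum !(tnth_nth 0%N) (tnth_nth ord0) (nth_map ord0) //.
  by rewrite size_tuple.
have size_e : size (incr_last e) = q.+1 by rewrite size_incr_last se.
have dE (i : 'I_q.+1) : nth 0%N (map val d) i = tnth d i.
  by rewrite (tnth_nth ord0) (nth_map ord0) // size_tuple.
rewrite /mzeta size_e -esumZl //; last first.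
  move=> n qn; rewrite lee_fin -size_e.
  by apply: zeta_term_ge0; rewrite ?size_e.
apply: eq_esum => n qn; rewrite -EFinM; congr (_%:E).
rewrite /shift_coef big_split /=; congr (_ * _); last first.
  apply: eq_bigr => i _; rewrite ne ?ltn_ord //.
  by rewrite dE.
rewrite -natr_prod; congr (_%:R).
have sd : size (map val d) = q.+1 by rewrite size_map size_tuple.
rewrite big_ord_recr /Mcoef size_tuple /=; congr (_ * _)%N.
  by apply: eq_bigr => i _; rewrite -dE alphaE !nth_rcons ss ltn_ord.
rewrite alphaE last_rcons nth_rcons ss ltnn eqxx -(nth_last 0%N (map _ _)) sd.
by rewrite -dE addSn subn1.
Qed.
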